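(* Let $G$ be a group and let $A$ be a set. Equip $A^G$ with its prodiscrete uniform structure and the shift action of $G$. Then two configurations in $A^G$ are homoclinic if and only if they are almost equal.
   Context: $A^G$ is the set of all maps $x \colon G \to A$ (configurations). The shift action is $(gx)(h) = x(g^{-1}h)$ for $g,h \in G$, $x \in A^G$. The prodiscrete uniform structure on $A^G$ is the product of the discrete uniform structures on the factors $A$; a base of entourages is given by the sets $W(\Omega) = \{(x,y) \in A^G \times A^G : x|_\Omega = y|_\Omega\}$, $\Omega$ ranging over finite subsets of $G$. Two points $x,y$ of a uniform space $X$ with a uniformly continuous action of $G$ are homoclinic if for every entourage $U$ of $X$ there is a finite subset $\Omega \subset G$ with $(gx,gy) \in U$ for all $g \in G \setminus \Omega$. Two configurations $x,y \in A^G$ are almost equal if there is a finite subset $\Omega \subset G$ with $x(g) = y(g)$ for all $g \in G \setminus \Omega$. *)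

(* Defs.v *)
From mathcomp Require Import all_boot.
From mathcomp Require Import finmap all_classical topology.

Set Implicit Arguments.
Unset Strict Implicit.
Unset Printing Implicit Defensive.

Local Open Scope classical_set_scope.
Local Open Scope group_scope.

(* Each g acts by a uniformly continuous map; G carries no topology. *)
Record unif_action (G : groupType) (X : uniformType) := UnifAction {
  unif_act :> G -> X -> X;
  unif_act1 : forall x, unif_act 1 x = x;
  unif_actM : forall g h x, unif_act (g * h) x = unif_act g (unif_act h x);
  unif_act_continuous : forall g, unif_continuous (unif_act g)
}.

Definition homoclinic (G : groupType) (X : uniformType) (a : unif_action G X)
    (x y : X) :=
  forall U : set (X * X), entourage U ->
    exists Omega : set G, finite_set Omega /\
      forall g, ~ Omega g -> U (a g x, a g y).

(* A^G with the product of the discrete uniformities; {classic A} only supplies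
   the choiceType structure that uniformType requires of its carrier. *)
Definition config (G : groupType) (A : Type) : uniformType :=
  {ptws G -> discrete_topology {classic A}}.

Definition almost_equal (G : groupType) (A : Type) (x y : config G A) :=
  exists Omega : set G, finite_set Omega /\ forall g, ~ Omega g -> x g = y g.

Section shift.
Variables (G : groupType) (A : Type).

Definition shift_fun (g : G) (x : config G A) : config G A :=
  fun h => x (g^-1 * h).

Lemma shift_fun1 x : shift_fun 1 x = x.
Proof. by apply/funext => h; rewrite /shift_fun invg1 mul1g. Qed.

Lemma shift_funM g h x : shift_fun (g * h) x = shift_fun g (shift_fun h x).
Proof. by apply/funext => k; rewrite /shift_fun invgM mulgA. Qed.

(* The sets W(Omega), Omega finite, form a base of the prodiscrete uniformity. *)
Definition agree_on (Omega : set G) : set (config G A * config G A) :=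
  [set p | forall g, Omega g -> p.1 g = p.2 g].

Lemma config_entourageP (U : set (config G A * config G A)) :
  entourage U <-> exists2 Omega, finite_set Omega & agree_on Omega `<=` U.
Proof.
split.
  rewrite /entourage/=/sup_ent/= => -[_ [F _ <-] FU].
  exists ((fun p => (projT1 p).1) @` [set` F]).
    exact/finite_image/finite_fset.
  apply: subset_trans FU => -[x y] xy [[g V] gV] /= Fp.
  have /asboolP [B entB BV] := gV.
  apply: BV => /=.
  move: entB; rewrite uniform_discrete; apply.
  exists (x g) => //; congr pair; apply: xy.
  by exists (exist _ (g, V) gV).
move=> [Omega /finite_fsetP[F ->] FU].
apply: filterS FU _.
have -> : agree_on [set` F] = \bigcap_(g in [set` F]) agree_on [set g].
  apply/seteqP; split=> [p pF g Fg _ -> | p pF g Fg]; first exact: pF.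
  exact: (pF g Fg).
apply: filter_bigI => g _.
exists (agree_on [set g]) => //.
have gP : `[< @entourage (initial_topology
    (@proj G (fun=> discrete_topology {classic A}) g)) (agree_on [set g]) >].
  apply/asboolP; exists [set p | p.1 = p.2].
    by rewrite uniform_discrete => _ [a _ <-].
  by move=> p /= pg _ ->.
exact: (@finI_from1 _ _ _ _ (exist _ (g : {classic G}, agree_on [set g]) gP)).
Qed.

Lemma shift_fun_continuous g : unif_continuous (shift_fun g).
Proof.
move=> U /config_entourageP[Omega finOmega OmegaU].
apply/config_entourageP; exists ((fun h => g^-1 * h) @` Omega).
  exact: finite_image.
by move=> p pO; apply: OmegaU => h Oh; apply: pO; exists h.
Qed.

Definition shift : unif_action G (config G A) :=
  UnifAction shift_fun1 shift_funM shift_fun_continuous.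

End shift.

Arguments shift : clear implicits.

(* Main.v *)
Require Import Defs.
From mathcomp Require Import all_boot.
From mathcomp Require Import all_classical topology.

(** Since (gx)(h) = x(g^-1 h), the configurations gx and gy agree on F exactly when x and y agree on
    g^-1 F. For finite F and [Omega], the translate g^-1 F meets [Omega] for only finitely many
    g. *)

Theorem proposition5p2 (G : groupType) (A : Type) (x y : config G A) :
  homoclinic (shift G A) x y <-> almost_equal x y.
Proof.
split=> [hxy | [Omega [finOmega xy]] U /config_entourageP[F finF FU]].
  (* Homoclinicity for W({1}) suffices, since (g x)(1) = x(g^-1). *)
  have /hxy[Omega [finOmega xy]] : entourage (@agree_on G A (set1 1%g)).
    by apply/config_entourageP; exists (set1 1%g).
  exists (image Omega (fun g => g^-1)%g); split; first exact: finite_image.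
  move=> g ng.
  have /xy/(_ 1%g erefl) : ~ Omega g^-1%g.
    by move=> Og; apply: ng; exists g^-1%g => //; rewrite invgK.
  by rewrite /= /shift_fun invgK mulg1.
(* If h in F and w = g^-1 h lies in [Omega], then g = h w^-1; so g^-1 F avoids [Omega] once g is
   outside F [Omega]^-1. *)
exists (image2 F Omega (fun h w => h * w^-1)%g).
split; first exact: finite_image2.
move=> g ng; apply: FU => h Fh; apply: xy => Oh; apply: ng.
by exists h => //; exists (g^-1 * h)%g => //; rewrite invgM invgK mulgA mulgV mul1g.
Qed.
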